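(* Let $l, r, n$ be positive integers with $r \mid nl$, let $m = nl/r$, and let $p \in [0,1]$. Consider the noiseless group testing system with parameter $p$. For every $(l,r,n)$-regular pooling graph $G$ and every estimator $\Phi : \{0,1\}^m \to \{0,1\}^n$, the estimation error probability $P_e = \Pr(\Phi(F_G(X)) \neq X)$ satisfies $$h(p) - \frac{l}{r}\, h\big((1-p)^r\big) - \frac{1}{n} \le P_e .$$
   Context: $h(x) = -x\log_2 x - (1-x)\log_2(1-x)$ is the binary entropy function (with $0\log_2 0 = 0$). Pooling graph: an $(l,r,n)$-regular pooling graph is a bipartite graph $G=(V_L,V_R,E)$ with $n$ left nodes labeled $1,\dots,n$ and $m = nl/r$ right nodes labeled $1,\dots,m$, in which every left node has degree $l$ and every right node has degree $r$. The neighbor set of right node $j$ is $M(j)=\{i\in\{1,\dots,n\} : (i,j)\in E\}$, so $|M(j)|=r$. Noiseless system: $X=(X_1,\dots,X_n)$ with $X_i$ i.i.d. Bernoulli, $\Pr(X_i=1)=p$, $\Pr(X_i=0)=1-p$. The test results are $Y=(Y_1,\dots,Y_m)=F_G(X)$, where $Y_j$ is the logical OR of the $X_i$, $i\in M(j)$ (i.e. $Y_j=0$ if all these $X_i$ are $0$, and $Y_j=1$ otherwise). *)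

(* Defs.v *)
From HB Require Import structures.
From mathcomp Require Import all_boot all_order all_algebra.
From mathcomp Require Import all_classical all_reals all_analysis.

Set Implicit Arguments.
Unset Strict Implicit.
Unset Printing Implicit Defensive.

Import Order.TTheory GRing.Theory Num.Theory.

Local Open Scope classical_set_scope.
Local Open Scope ring_scope.

Definition log2 (R : realType) (x : R) : R := ln x / ln 2.

(* [0 * log2 0 = 0] holds whatever the value of [ln 0]. *)
Definition binary_entropy (R : realType) (x : R) : R :=
  - (x * log2 x) - (1 - x) * log2 (1 - x).

(* A simple bipartite graph with left part ['I_n] and right part ['I_m] is
   given by its edge set; labels start at 0. *)
Definition bipartite_graph (n m : nat) := {set 'I_n * 'I_m}.

Definition left_neighbors (n m : nat) (G : bipartite_graph n m) (i : 'I_n) :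
  {set 'I_m} := [set j | (i, j) \in G]%SET.

Definition right_neighbors (n m : nat) (G : bipartite_graph n m) (j : 'I_m) :
  {set 'I_n} := [set i | (i, j) \in G]%SET.

Definition regular_pooling_graph (l r n m : nat) (G : bipartite_graph n m) :
    Prop :=
  [/\ m = (n * l %/ r)%N,
      forall i : 'I_n, #|left_neighbors G i| = l
    & forall j : 'I_m, #|right_neighbors G j| = r].

Definition test_results (n m : nat) (G : bipartite_graph n m)
    (x : {ffun 'I_n -> bool}) : {ffun 'I_m -> bool} :=
  [ffun j => \big[orb/false]_(i in right_neighbors G j) x i].

Definition mutually_independent (d d' : measure_display)
    (T : measurableType d) (T' : measurableType d') (R : realType)
    (P : probability T R) (n : nat) (X : 'I_n -> {RV P >-> T'}) : Prop :=
  forall (J : {set 'I_n}) (A : 'I_n -> set T'),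
    (forall i, measurable (A i)) ->
    P [set t | forall i, i \in J -> A i (X i t)] =
    (\prod_(i in J) P (X i @^-1` A i))%E.

Definition iid_bernoulli (d : measure_display) (T : measurableType d)
    (R : realType) (P : probability T R) (n : nat) (p : R)
    (X : 'I_n -> {RV P >-> bool}) : Prop :=
  mutually_independent X /\
  forall (i : 'I_n) (A : set bool), distribution P (X i) A = bernoulli_prob p A.

Definition random_vector (d : measure_display) (T : measurableType d)
    (R : realType) (P : probability T R) (n : nat)
    (X : 'I_n -> {RV P >-> bool}) (t : T) : {ffun 'I_n -> bool} :=
  [ffun i => X i t].

Definition error_probability (d : measure_display) (T : measurableType d)
    (R : realType) (P : probability T R) (n m : nat)
    (X : 'I_n -> {RV P >-> bool}) (G : bipartite_graph n m)
    (Phi : {ffun 'I_m -> bool} -> {ffun 'I_n -> bool}) : \bar R :=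
  P [set t | Phi (test_results G (random_vector X t)) <> random_vector X t].

(* Main.v *)
(* Fano's inequality combined with Gibbs' inequality: n h(p) is the entropy of
   X, so it is at most the cross entropy of X relative to any subprobability Q.
   Take Q(x) = W(F x) ([Phi(F x) = x] + 2^-n) / 2, where W is the product of the
   marginal laws of the tests.  Then -log2 Q(x) exceeds -log2 W(F x) by at most
   1 when x is decoded correctly and by at most 1 + n otherwise, and the
   expectation of -log2 W(F X) is m h((1-p)^r) because each test is negative
   with probability (1-p)^r. *)
Require Import Defs.
From mathcomp Require Import all_boot all_order all_algebra.
From mathcomp Require Import all_classical all_reals all_analysis.
From mathcomp Require Import ring lra.

Set Implicit Arguments.
Unset Strict Implicit.
Unset Printing Implicit Defensive.

Import Order.TTheory GRing.Theory Num.Theory.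

Local Open Scope ring_scope.

(** * Base-two logarithm *)

Lemma ln2_gt0 (R : realType) : 0 < ln 2 :> R.
Proof. by rewrite ln_gt0 // ltr1n. Qed.

Lemma log21 (R : realType) : log2 (1 : R) = 0.
Proof. by rewrite /log2 ln1 mul0r. Qed.

Lemma log22 (R : realType) : log2 (2 : R) = 1.
Proof. by rewrite /log2 divff // gt_eqF // ln2_gt0. Qed.

Lemma log2M (R : realType) (x y : R) :
  0 < x -> 0 < y -> log2 (x * y) = log2 x + log2 y.
Proof. by move=> x0 y0; rewrite /log2 lnM ?posrE // mulrDl. Qed.

Lemma log2V (R : realType) (x : R) : 0 < x -> log2 x^-1 = - log2 x.
Proof. by move=> x0; rewrite /log2 lnV ?posrE // mulNr. Qed.

Lemma log2_pow2 (R : realType) (n : nat) : log2 (2 ^+ n : R) = n%:R.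
Proof.
rewrite /log2 lnXn // -(mulr_natl (ln 2)) mulfK //.
by rewrite gt_eqF // ln2_gt0.
Qed.

Lemma ler_log2 (R : realType) (x y : R) :
  0 < x -> x <= y -> log2 x <= log2 y.
Proof.
move=> x0 xy; rewrite ler_pM2r ?invr_gt0 ?ln2_gt0 //.
by rewrite ler_ln // posrE (lt_le_trans x0).
Qed.

Lemma log2_prod (R : realType) (I : finType) (f : I -> R) :
  (forall i, 0 < f i) -> log2 (\prod_i f i) = \sum_i log2 (f i).
Proof.
move=> f0; suff [] : log2 (\prod_i f i) = \sum_i log2 (f i)
  /\ 0 < \prod_i f i by [].
elim/big_rec2: _ => [|i y x _ [<- x0]]; first by rewrite log21.
by rewrite log2M // mulr_gt0.
Qed.

(** * Gibbs' and Fano's inequalities on finite types *)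

(** By [ln (1 + u) <= u] at [u = Q x / P x - 1], each term of the difference is at most
    [(Q x - P x) / ln 2], and these sum to at most 0. *)
Lemma gibbs (R : realType) (T : finType) (P Q : T -> R) :
  (forall x, 0 < P x) -> (forall x, 0 < Q x) ->
  \sum_x Q x <= \sum_x P x ->
  \sum_x P x * log2 (Q x) <= \sum_x P x * log2 (P x).
Proof.
move=> P0 Q0 QP.
have ln2V_gt0 : 0 < (ln 2 : R)^-1 by rewrite invr_gt0 ln2_gt0.
suff : \sum_x (P x * log2 (Q x) - P x * log2 (P x)) <= 0.
  by rewrite sumrB subr_le0.
apply: (@le_trans _ _ (\sum_x (Q x - P x) / ln 2)); last first.
  by rewrite -mulr_suml sumrB pmulr_lle0 // subr_le0.
apply: ler_sum => x _.
rewrite -mulrBr /log2 -mulrBl mulrA ler_pM2r // -ln_div ?posrE //.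
have QPx : 0 < Q x / P x by rewrite divr_gt0.
have lnQP : ln (1 + (Q x / P x - 1)) <= Q x / P x - 1 by apply: le_ln1Dx; lra.
move: lnQP; rewrite subrKC => lnQP.
apply: (le_trans (ler_wpM2l (ltW (P0 x)) lnQP)).
by rewrite mulrBr mulr1 mulrCA divff ?mulr1 // gt_eqF.
Qed.

(** Leaving [W] free, instead of fixing it as the law of [F x], allows a product law on the
    observations later. *)
Lemma fano (R : realType) (A B : finType) (P : A -> R) (W : B -> R)
    (F : A -> B) (Phi : B -> A) :
  (forall x, 0 < P x) -> \sum_x P x = 1 ->
  (forall y, 0 < W y) -> \sum_y W y = 1 ->
  \sum_x P x * log2 (W (F x)) - 1
    - log2 #|A|%:R * \sum_(x | Phi (F x) != x) P x
  <= \sum_x P x * log2 (P x).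
Proof.
move=> P0 P1 W0 W1.
set N : R := #|A|%:R.
have [x0 _|A0] := pickP (fun _ : A => true); last first.
  by move: P1; rewrite big_pred0 // => /eqP; rewrite eq_sym oner_eq0.
have N_gt0 : 0 < N by rewrite ltr0n; apply/card_gt0P; exists x0.
(* A guess of [x]: draw [y] from [W], then toss a fair coin between [Phi y] and
   a uniform guess; restricted to the guesses consistent with [y]. *)
pose Q x := W (F x) * (((Phi (F x) == x)%:R + N^-1) / 2).
have Q0 x : 0 < Q x.
  rewrite mulr_gt0 // divr_gt0 // ltr_wpDl ?invr_gt0 //; exact: ler0n.
have Q1 : \sum_x Q x <= \sum_x P x.
  rewrite P1 -W1 (partition_big F xpredT) //=; apply: ler_sum => y _.
  (* Dropping the constraint [F x = y] only adds nonnegative terms; the full sum is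
     [W y * ((1 + 1) / 2)], one unit from [Phi y] and one from the uniform guess. *)
  apply: (@le_trans _ _ (\sum_x W y * (((Phi y == x)%:R + N^-1) / 2))).
    rewrite [leRHS](bigID (fun x => F x == y)) /=.
    rewrite [leLHS](_ : _ =
      \sum_(x | F x == y) W y * (((Phi y == x)%:R + N^-1) / 2)); last first.
      by apply: eq_bigr => x /eqP Fx; rewrite /Q Fx.
    rewrite lerDl sumr_ge0 // => x _.
    rewrite mulr_ge0 ?(ltW (W0 _)) // divr_ge0 // addr_ge0 //.
    by rewrite invr_ge0 ltW.
  rewrite -mulr_sumr -mulr_suml big_split /= sumr_const -(mulr_natl N^-1).
  rewrite divff ?gt_eqF // (bigD1 (Phi y)) //= eqxx big1 => [|x].
    by rewrite addr0 -[X in _ + X]/(1%:R) -natrD divff ?mulr1.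
  by rewrite eq_sym => /negbTE ->.
apply: le_trans (gibbs P0 Q0 Q1).
rewrite -[X in _ - X - _]P1 mulr_sumr [X in _ - _ - X]big_mkcond /= -!sumrB.
apply: ler_sum => x _.
rewrite /Q log2M ?divr_gt0 ?ltr_wpDl ?invr_gt0 //.
have -> : (if Phi (F x) != x then log2 N * P x else 0)
  = P x * ((Phi (F x) != x)%:R * log2 N).
  by case: ifP => _; rewrite ?mul1r ?mul0r ?mulr0 // mulrC.
rewrite -[X in _ - X - _]mulr1 -!mulrBr ler_pM2l // -addrA lerD2l.
rewrite log2M ?ltr_wpDl ?invr_gt0 // log2V // log22 addrC lerD2r.
(* An error gives equality, since only [N^-1] remains inside the logarithm; a correct guess leaves
   [0 <= log2 (1 + N^-1)]. *)
case: eqP => _ /=; rewrite ?mul1r ?mul0r ?add0r ?log2V // oppr0.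
by rewrite -[leLHS](log21 R) ler_log2 // lerDl invr_ge0 ltW.
Qed.

(** * Product Bernoulli laws: expectations and entropy *)

Definition product_pmf (R : realType) (I : finType) (p : R)
  (x : {ffun I -> bool}) : R := \prod_i bernoulli_pmf p (x i).

Lemma bernoulli_pmf_gt0 (R : realType) (p : R) (b : bool) :
  0 < p < 1 -> 0 < bernoulli_pmf p b.
Proof. by case/andP=> p0 p1; case: b => //=; rewrite subr_gt0. Qed.

Lemma product_pmf_gt0 (R : realType) (I : finType) (p : R)
    (x : {ffun I -> bool}) : 0 < p < 1 -> 0 < product_pmf p x.
Proof. by move=> p01; apply: prodr_gt0 => i _; exact: bernoulli_pmf_gt0. Qed.

(** Distributivity of product over sum. Suitable choices of [f] yield the total mass, the marginals
    and the probability of a negative test. *)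
Lemma product_pmf_expectation_prod (R : realType) (I : finType) (p : R)
    (f : I -> bool -> R) :
  \sum_(x : {ffun I -> bool}) product_pmf p x * \prod_i f i (x i)
  = \prod_i (p * f i true + (1 - p) * f i false).
Proof.
rewrite (eq_bigr (fun x : {ffun I -> bool} =>
  \prod_i (bernoulli_pmf p (x i) * f i (x i)))) => [|x _]; last first.
  by rewrite big_split.
rewrite -(bigA_distr_bigA (fun i b => bernoulli_pmf p b * f i b)).
by apply: eq_bigr => i _; rewrite big_bool.
Qed.

Lemma sum_product_pmf (R : realType) (I : finType) (p : R) :
  \sum_(x : {ffun I -> bool}) product_pmf p x = 1.
Proof.
transitivity (\prod_(i : I) (p * 1 + (1 - p) * 1)); last first.
  by rewrite big1 // => i _; ring.
rewrite -(product_pmf_expectation_prod p (fun=> fun=> 1)).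
by apply: eq_bigr => x _; rewrite big1_eq mulr1.
Qed.

Lemma product_pmf_expectation_coord (R : realType) (I : finType) (p : R)
    (i : I) (g : bool -> R) :
  \sum_(x : {ffun I -> bool}) product_pmf p x
    * g (x i)
  = p * g true + (1 - p) * g false.
Proof.
pose f k b := if k == i then g b else 1.
transitivity (\prod_k (p * f k true + (1 - p) * f k false)).
  rewrite -product_pmf_expectation_prod; apply: eq_bigr => x _.
  by rewrite -big_mkcond big_pred1_eq.
rewrite (bigD1 i) //= big1 /f ?eqxx ?mulr1 // => k /negbTE ->; ring.
Qed.

Lemma product_pmf_all_false (R : realType) (I : finType) (p : R)
    (A : {set I}) :
  \sum_(x : {ffun I -> bool}) product_pmf p x
    * (~~ \big[orb/false]_(i in A) x i)%:R
  = (1 - p) ^+ #|A|.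
Proof.
(* The indicator that the OR over [A] is false factors over coordinates. *)
pose f k b : R := if k \in A then (~~ b)%:R else 1.
transitivity (\prod_k (p * f k true + (1 - p) * f k false)).
  rewrite -product_pmf_expectation_prod; apply: eq_bigr => x _; congr (_ * _).
  rewrite -big_mkcond; elim/big_rec2: _ => // i y b _ <-.
  by case: (x i); rewrite /= ?mul0r ?mul1r.
rewrite -prodr_const [RHS]big_mkcond; apply: eq_bigr => k _.
by rewrite /f; case: ifP => _ /=; ring.
Qed.

Lemma product_pmf_entropy (R : realType) (I : finType) (p : R) :
  0 < p < 1 ->
  \sum_(x : {ffun I -> bool}) product_pmf p x * log2 (product_pmf p x)
  = - (#|I|%:R * binary_entropy p).
Proof.
move=> p01.
under eq_bigr => x _.
  rewrite [in log2 _]/product_pmf log2_prod; last first.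
    by move=> i; exact: bernoulli_pmf_gt0.
  rewrite mulr_sumr.
  over.
rewrite exchange_big /=.
under eq_bigr => i _.
  rewrite (product_pmf_expectation_coord p i
    (fun b => log2 (bernoulli_pmf p b))).
  over.
rewrite sumr_const -mulrN mulr_natl /binary_entropy /=.
by congr (_ *+ _); ring.
Qed.

(* Only the marginal law of each test enters the cross entropy with a product
   law, so the dependence between tests plays no role. *)
Lemma test_results_cross_entropy (R : realType) (n m r : nat)
    (G : bipartite_graph n m) (p : R) :
  (forall j, #|right_neighbors G j| = r) -> 0 < (1 - p) ^+ r < 1 ->
  \sum_(x : {ffun 'I_n -> bool}) product_pmf p x
    * log2 (product_pmf (1 - (1 - p) ^+ r) (test_results G x))
  = - (m%:R * binary_entropy ((1 - p) ^+ r)).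
Proof.
move=> degG; set q := (1 - p) ^+ r => q01.
have q01' : 0 < 1 - q < 1 by apply/andP; split; lra.
under eq_bigr => x _.
  rewrite [in log2 _]/product_pmf log2_prod; last first.
    by move=> i; exact: bernoulli_pmf_gt0.
  rewrite mulr_sumr.
  over.
rewrite exchange_big /= -[m in RHS]card_ord.
rewrite -mulrN mulr_natl -sumr_const; apply: eq_bigr => j _.
under eq_bigr => x _.
  rewrite ffunE.
  (* The log-likelihood of a test is affine in the indicator of a negative result, so its
     expectation follows from the probability [q] of that result. *)
  rewrite (_ : log2 _ = log2 (1 - q)
    + (~~ \big[orb/false]_(i in right_neighbors G j) x i)%:R
      * (log2 q - log2 (1 - q))); last first.
    by case: (\big[orb/false]_(i in _) _) => /=; rewrite ?subKr; ring.
  rewrite mulrDr mulrA.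
  over.
rewrite big_split /= -!mulr_suml sum_product_pmf product_pmf_all_false degG.
by rewrite /binary_entropy -/q; ring.
Qed.

(** * From the probability space to finite sums *)

Lemma random_vector_law (R : realType) (n : nat) (p : R) (p01 : 0 <= p <= 1)
    (d : measure_display) (T : measurableType d) (P : probability T R)
    (X : 'I_n -> {RV P >-> bool}) (iidX : iid_bernoulli p X)
    (S : pred {ffun 'I_n -> bool}) :
  P [set t | S (random_vector X t)]%classic
  = (\sum_(x | S x) product_pmf p x)%:E.
Proof.
have [indX lawX] := iidX.
(* The event that the random vector equals [x], in the shape of [mutually_independent] with [J]
   full. The event for [S] is a finite disjoint union of these. *)
pose E (x : {ffun 'I_n -> bool}) :=
  [set t | forall i, i \in [set: 'I_n]%SET -> [set x i]%classic (X i t)]%classic.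
have PE x : P (E x) = (product_pmf p x)%:E.
  rewrite (indX _ (fun i => [set x i]%classic)) //.
  rewrite -prodEFin; apply: eq_big => [i|i _]; first by rewrite inE.
  transitivity (distribution P (X i) [set x i]%classic) => //.
  rewrite lawX bernoulli_probE // !diracE.
  have in1 b : (b \in [set x i]%classic) = (b == x i).
    by apply/idP/eqP; rewrite in_setE.
  by rewrite !in1; case: (x i); rewrite /= ?mule1 ?mule0 ?adde0 ?add0e.
have EP x t : E x t <-> random_vector X t = x.
  split=> [Et|<- i _]; last by rewrite ffunE.
  by apply/ffunP => i; rewrite ffunE; apply: Et; rewrite inE.
have mE x : d.-measurable%classic (E x).
  rewrite (_ : E x =
      (\bigcap_(i in [set: 'I_n]) (X i @^-1` [set x i]))%classic).
    apply: fin_bigcap_measurable => [|i _]; first exact: finite_finset.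
    exact: measurable_funPTI.
  by apply/seteqP; split=> t Et i _; apply: Et; rewrite ?inE.
rewrite (_ : [set t | _]%classic = (\bigcup_(x in [set` S]) E x)%classic);
  last first.
  apply/seteqP; split=> t /=.
    by move=> St; exists (random_vector X t) => //; apply/EP.
  by case=> x Sx /EP ->.
rewrite measure_fin_bigcup //; last first.
  by move=> x y _ _ [t [/EP <- /EP <-]].
rewrite -sumEFin -[RHS]big_filter.
rewrite [RHS]fsbig_seq ?filter_uniq ?index_enum_uniq //.
rewrite (eq_fsbigr (fun x => (product_pmf p x)%:E)) => [|x _]; last exact: PE.
apply: eq_fsbigl; apply/seteqP; split=> x /=;
  by rewrite mem_filter mem_index_enum andbT.
Qed.

(** * Degenerate parameters and the final bound *)

Lemma binary_entropy0 (R : realType) : binary_entropy (0 : R) = 0.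
Proof. by rewrite /binary_entropy subr0 log21 mul0r mulr0 subr0 oppr0. Qed.

Lemma binary_entropy1 (R : realType) : binary_entropy (1 : R) = 0.
Proof. by rewrite /binary_entropy subrr log21 mul0r mulr0 subr0 oppr0. Qed.

Theorem theorem1 (R : realType) (l r n m : nat)
    (l_gt0 : (0 < l)%N) (r_gt0 : (0 < r)%N) (n_gt0 : (0 < n)%N)
    (r_dvd : (r %| n * l)%N)
    (p : R) (p01 : 0 <= p <= 1)
    (d : measure_display) (T : measurableType d) (P : probability T R)
    (X : 'I_n -> {RV P >-> bool}) (iidX : iid_bernoulli p X)
    (G : bipartite_graph n m) (regG : regular_pooling_graph l r G)
    (Phi : {ffun 'I_m -> bool} -> {ffun 'I_n -> bool}) :
  ((binary_entropy p - l%:R / r%:R * binary_entropy ((1 - p) ^+ r)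
     - 1 / n%:R)%:E <= error_probability X G Phi)%E.
Proof.
have [mE _ degG] := regG.
have n_gt0R : 0 < n%:R :> R by rewrite ltr0n.
have n_neq0 : n%:R != 0 :> R by rewrite gt_eqF.
have r_neq0 : r%:R != 0 :> R by rewrite pnatr_eq0 -lt0n.
have mr : m%:R = n%:R * (l%:R / r%:R) :> R.
  apply: (mulIf r_neq0); rewrite -mulrA divfK // -!natrM.
  by rewrite mE divnK.
rewrite /error_probability.
rewrite (_ : [set t | _]%classic = [set t |
    Phi (test_results G (random_vector X t)) != random_vector X t]%classic);
  last first.
  by apply/seteqP; split=> t /= /eqP.
rewrite (random_vector_law p01 iidX (fun x => Phi (test_results G x) != x)).
rewrite lee_fin; set Pe := \sum_(x | _) _.
(* [fano] requires positive laws, which excludes [p = 0] and [p = 1]. There both entropies vanish,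
   and the claim is [- (1 / n) <= Pe]. *)
have [p01' | p_end] := boolP (0 < p < 1); last first.
  have Pe0 : 0 <= Pe.
    apply: sumr_ge0 => x _; apply: prodr_ge0 => i _.
    exact: bernoulli_pmf_ge0.
  have [-> ->] : binary_entropy p = 0 /\ binary_entropy ((1 - p) ^+ r) = 0.
    case/andP: p01 => p0 p1; move: p_end; rewrite !lt_neqAle p0 p1 !andbT.
    rewrite negb_and !negbK => /orP[]/eqP.
      by move=> <-; rewrite subr0 expr1n binary_entropy0 binary_entropy1.
    move=> ->; rewrite subrr expr0n eqn0Ngt r_gt0.
    by rewrite binary_entropy0 binary_entropy1.
  by rewrite mulr0 subr0 sub0r (le_trans _ Pe0) // oppr_le0 divr_ge0.
set q := (1 - p) ^+ r.
have q01 : 0 < q < 1.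
  case/andP: p01' => p0 p1.
  by rewrite exprn_gt0 ?subr_gt0 // exprn_ilt1 ?subr_ge0 ?ltW // -?lt0n //; lra.
have q01' : 0 < 1 - q < 1 by apply/andP; split; lra.
have := fano (test_results G) Phi (fun x => product_pmf_gt0 x p01')
  (sum_product_pmf _ _) (fun y => product_pmf_gt0 y q01') (sum_product_pmf _ _).
rewrite product_pmf_entropy // (test_results_cross_entropy degG q01).
(* With [log2 (2 ^+ n) = n], [fano] becomes [n] times the claim. *)
rewrite card_ffun card_bool !card_ord natrX log2_pow2 -/Pe -/q mr.
move=> fanoG; rewrite -(ler_pM2l n_gt0R) 2!mulrBr mulrA mul1r mulfV //.
lra.
Qed.
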